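(* For every real $b\neq2$, the peakon $u(t,x)=\phi(x-t)$ of the $b$-Camassa--Holm equation $$u_t+uu_x+\tfrac14\phi'\ast\left[bu^2+(3-b)u_x^2\right]=0$$ is linearly unstable (in the sense defined in the context) in the class $$Y=C(\mathbb{R},\mathrm{Dom}(L))\cap C^1(\mathbb{R},L^2(\mathbb{R})).$$
   Context: $\phi(\xi)=e^{-|\xi|}$, $\phi'(\xi)=-\mathrm{sgn}(\xi)e^{-|\xi|}$ for $\xi\ne0$, $\ast$ is convolution on $\mathbb{R}$, $\langle\cdot,\cdot\rangle$ is the inner product of $L^2(\mathbb{R})$, $b\in\mathbb{R}$. Let $$Q(v)=\tfrac12(b-3)\,\phi\ast(\phi' v)-\tfrac12(2b-3)\,\phi'\ast(\phi v),\qquad L=(1-\phi)\partial_\xi+(2-b)\phi'+Q,$$ $$\mathrm{Dom}(L)=\{v\in L^2(\mathbb{R}):\ (1-\phi)v'\in L^2(\mathbb{R})\},$$ where the derivative is understood away from $\xi=0$ (weak derivative on $\mathbb{R}\setminus\{0\}$), and $\mathrm{Dom}(L)$ carries the graph norm. The linearized equation is $$\tilde v_t=L\tilde v-\tfrac32(b-2)\langle\phi\phi',\tilde v\rangle\phi.\qquad(\ast)$$ Definition: the peakon is linearly stable if for every $\tilde v_0\in\mathrm{Dom}(L)$ there exist a positive constant $C$ and a unique solution $\tilde v\in C(\mathbb{R},\mathrm{Dom}(L))$ of $(\ast)$ with $\tilde v(0,\xi)=\tilde v_0(\xi)$ such that $\|\tilde v(t,\cdot)\|_{L^2}\le C\|\tilde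 v_0\|_{L^2}$ for all $t>0$. Otherwise it is linearly unstable. *)

(* Defs.v *)
From HB Require Import structures.
From mathcomp Require Import all_boot all_order all_algebra.
From mathcomp Require Import all_classical all_reals all_analysis.
Set Implicit Arguments.
Unset Strict Implicit.
Unset Printing Implicit Defensive.
Import Order.TTheory GRing.Theory Num.Theory.
Import numFieldNormedType.Exports.
Local Open Scope classical_set_scope.
Local Open Scope ring_scope.

Section peakon.
Context {R : realType}.
Local Notation mu := (@lebesgue_measure R).
Implicit Types (b t : R) (f g v w : R -> R).

Definition phi (x : R) : R := expR (- `|x|).

(* Num.sg 0 = 0, so dphi 0 = 0; every use of dphi is up to null sets. *)
Definition dphi (x : R) : R := - Num.sg x * expR (- `|x|).

Definition convolution f g (x : R) : R := \int[mu]_y (f (x - y) * g y).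

(* Elements of L^2(R) are represented by functions; equality in L^2(R) is
   equality almost everywhere. *)
Definition L2 f : Prop := f \in Lfun mu 2%:E.
Definition L2norm f : \bar R := 'N[mu]_2%:E[EFin \o f].
Definition inner f g : R := \int[mu]_x (f x * g x).

(* C^oo functions whose support is a compact subset of R \ {0} *)
Definition test_function (psi : R -> R) : Prop :=
  [/\ forall n x, derivable (derive1n n psi) x 1,
      compact (closure [set x | psi x != 0]) &
      closure [set x | psi x != 0] `<=` ~` [set 0]].

(* w is the weak derivative of v on R \ {0}; its value at 0 is irrelevant. *)
Definition weak_derivative v w : Prop :=
  locally_integrable (~` [set 0]) w /\
  forall psi, test_function psi ->
    \int[mu]_x (v x * derive1 psi x) = - \int[mu]_x (w x * psi x).

Definition Q b v (x : R) : R :=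
  (b - 3) / 2 * convolution phi (dphi \* v) x -
  (2 * b - 3) / 2 * convolution dphi (phi \* v) x.

Definition DomL v : Prop :=
  L2 v /\ exists2 w, weak_derivative v w & L2 (fun x => (1 - phi x) * w x).

(* The graph of L: v is in Dom(L) and f represents L v. The weak derivative w
   is determined by v almost everywhere, and hence so is f. *)
Definition L_graph b v f : Prop :=
  L2 v /\ exists w,
    [/\ weak_derivative v w, L2 (fun x => (1 - phi x) * w x) &
        {ae mu, forall x,
          f x = (1 - phi x) * w x + (2 - b) * dphi x * v x + Q b v x}].

(* For v in Dom(L) the set below is a singleton, because f = L v is unique
   almost everywhere; for v outside Dom(L) it is empty and the value is +oo. *)
Definition graph_norm b v : \bar R :=
  ereal_inf [set (L2norm v + L2norm f)%E | f in L_graph b v].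

(* A time-dependent function is v : R -> R -> R, with v t x = v(t, x). *)

Definition C_L2 (v : R -> R -> R) : Prop :=
  (forall t, L2 (v t)) /\
  forall t, L2norm (v s \- v t) @[s --> t] --> 0%E.

Definition C_DomL b (v : R -> R -> R) : Prop :=
  (forall t, DomL (v t)) /\
  forall t, graph_norm b (v s \- v t) @[s --> t] --> 0%E.

(* g is the derivative at time t of s |-> v s in the norm of L^2(R). *)
Definition L2_derivative (v : R -> R -> R) t g : Prop :=
  L2 g /\
  L2norm (fun x => h^-1 * (v (t + h) x - v t x) - g x) @[h --> 0^'] --> 0%E.

Definition C1_L2 (v : R -> R -> R) : Prop :=
  C_L2 v /\
  exists2 dv, forall t, L2_derivative v t (dv t) & C_L2 dv.

Definition class_Y b : set (R -> R -> R) := C_DomL b `&` C1_L2.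

Definition linearized_equation b (v : R -> R -> R) : Prop :=
  forall t, exists2 f, L_graph b (v t) f &
    L2_derivative v t
      (fun x => f x - 3 / 2 * (b - 2) * inner (phi \* dphi) (v t) * phi x).

Definition solution_in b (X : set (R -> R -> R)) v0 (v : R -> R -> R) : Prop :=
  [/\ X v, linearized_equation b v & {ae mu, forall x, v 0 x = v0 x}].

Definition peakon_linearly_stable b (X : set (R -> R -> R)) : Prop :=
  forall v0, DomL v0 ->
  exists C : R, 0 < C /\
  exists v : R -> R -> R,
    [/\ solution_in b X v0 v,
        forall v' : R -> R -> R, solution_in b X v0 v' ->
          forall t, {ae mu, forall x, v' t x = v t x} &
        forall t, 0 < t -> (L2norm (v t) <= C%:E * L2norm v0)%E].

Definition peakon_linearly_unstable b (X : set (R -> R -> R)) : Prop :=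
  ~ peakon_linearly_stable b X.

End peakon.

(* Main.v *)
Require Import Defs.
From mathcomp Require Import all_boot all_order all_algebra.
From mathcomp Require Import ring lra.
From mathcomp Require Import all_classical all_reals all_analysis.
From mathcomp Require Import measurable_realfun.
Set Implicit Arguments.
Unset Strict Implicit.
Unset Printing Implicit Defensive.
Import Order.TTheory GRing.Theory Num.Theory.
Import numFieldNormedType.Exports.
Local Open Scope classical_set_scope.
Local Open Scope ring_scope.

(* The plane spanned by phi and phi' is invariant: L phi = (2 - b) phi' and
   L phi' = 0, while <phi phi', phi> = 0 and <phi phi', phi'> = 2/3, so that the
   right-hand side of the linearized equation maps phi to (2 - b) phi' and phi'
   to (2 - b) phi. Its eigenvectors are phi + s phi' with s = 1 or s = -1 and
   eigenvalue s (2 - b). Choosing s so that s (2 - b) > 0 gives the solution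
   exp (s (2 - b) t) (phi + s phi'), which stays in Y and grows exponentially;
   uniqueness in the definition of stability rules out any other solution with
   the same initial value. The function phi + s phi' is 2 exp (s x) on the half
   line s x < 0 and vanishes on s x > 0, so every integral involved reduces to
   integrals of exponentials over half lines. *)

#[local] Instance lebesgue_ae_filter (R : realType) :
  Filter (nbhs (almost_everywhere (@lebesgue_measure R))).
Proof. exact: (ae_filter_ringOfSetsType (@lebesgue_measure R)). Qed.

(** * Integrals of exponentials over half lines *)

Section has_integral.
Context {R : realType}.
Local Notation mu := (@lebesgue_measure R).
Implicit Types (f g : R -> R) (a c k s x : R).

(** Integrability is kept together with the value because the real-valued integral is additive only
    for integrable functions. *)
Definition has_integral f a :=
  mu.-integrable setT (EFin \o f) /\ \int[mu]_x f x = a.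

Lemma has_integralZ c f a :
  has_integral f a -> has_integral (fun x => c * f x) (c * a).
Proof.
move=> [fi <-]; split; last by rewrite RintegralZl.
exact: (integrableZl measurableT c fi).
Qed.

Lemma has_integralD f g a c : has_integral f a -> has_integral g c ->
  has_integral (fun x => f x + g x) (a + c).
Proof.
move=> [fi <-] [gi <-]; split; last by rewrite RintegralD.
exact: (integrableD measurableT fi gi).
Qed.

(** The closed forms of the integrands below fail at isolated points such as the origin, so values
    have to be carried over from almost everywhere equal functions. *)
Lemma has_integral_ae f g a : measurable_fun setT f ->
  {ae mu, forall x, f x = g x} -> has_integral g a -> has_integral f a.
Proof.
move=> mf fg [gi <-].
have mg := measurable_int _ gi.
have /measurable_EFinP mF := mf.
split; last first.
  rewrite /Rintegral; congr fine; apply: ae_eq_integral => //.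
  by apply: filterS fg => x /= -> _.
apply/integrableP; split => //.
case/integrableP : gi => _; apply: le_lt_trans.
rewrite le_eqVlt; apply/orP; left; apply/eqP/ae_eq_integral => //.
- exact: measurableT_comp.
- exact: measurableT_comp.
- by apply: filterS fg => x /= -> _.
Qed.

Lemma ae_neq a : {ae mu, forall x, x != a}.
Proof.
exists [set a]; split => //; first exact: lebesgue_measure_set1.
by move=> x /= /negP; rewrite negbK => /eqP.
Qed.

(* The sign s = 1 or s = -1 selects the half line; it lets both unstable modes,
   for b < 2 and for b > 2, be treated by the same computations. *)
Definition halfexp s k a x : R := if s * x <= a then expR (k * (s * x)) else 0.

Lemma has_integral_ge0 f a : measurable_fun setT f -> (forall x, 0 <= f x) ->
  (\int[mu]_x (f x)%:E = a%:E)%E -> has_integral f a.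
Proof.
move=> mf f0 fa; split; last by rewrite /Rintegral fa.
apply/integrableP; split; first exact/measurable_EFinP.
under eq_integral do rewrite /= ger0_norm//.
by rewrite fa ltry.
Qed.

Lemma continuous_expRM k : continuous (fun x : R => expR (k * x)).
Proof.
move=> x; apply: continuous_comp; last exact: continuous_expR.
by apply: continuousM => //; exact: cst_continuous.
Qed.

Lemma measurable_expRM k : measurable_fun setT (fun x : R => expR (k * x)).
Proof. by apply: continuous_measurable_fun; exact: continuous_expRM. Qed.

Lemma measurable_halfexp s k a : measurable_fun setT (halfexp s k a).
Proof.
apply: measurable_fun_ifT => //.
  exact: measurable_fun_ler.
under eq_fun do rewrite mulrA; exact: measurable_expRM.
Qed.

Lemma integral_expR_right k a : 0 < k ->
  (\int[mu]_(x in `[a, +oo[) (expR (- k * x))%:E = (expR (- k * a) / k)%:E)%E.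
Proof.
move=> k0.
have cE := @continuous_expRM (- k).
(* This antiderivative tends to 0 at infinity, so only minus its value at [a] remains. *)
rewrite (@ge0_continuous_FTC2y _ _ (fun x => - k^-1 * expR (- k * x)) _ 0).
- by rewrite sub0e -EFinN mulNr opprK mulrC.
- by move=> x _; exact: expR_ge0.
- exact: continuous_subspaceT.
- rewrite -(mulr0 (- k^-1)); apply: cvgM; first exact: cvg_cst.
  rewrite (_ : (fun x => _) =
    (fun z => expR (- z)) \o (fun z => k * z)); last first.
    by apply/funext => x /=; rewrite mulNr.
  apply: (@cvg_comp _ _ _ _ _ _ (pinfty_nbhs R)); last exact: cvgr_expR.
  exact: gt0_cvgMry.
- by move=> x _; exact: ex_derive.
- by apply: cvg_at_right_filter; apply: cvgM; [exact: cvg_cst|exact: cE].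
- move=> x _.
  rewrite derive1E derive_val /GRing.scale /=.
  by field; rewrite gt_eqF.
Qed.

Lemma has_integral_halfexp s k a : s = 1 \/ s = -1 -> 0 < k ->
  has_integral (halfexp s k a) (expR (k * a) / k).
Proof.
move=> hs k0; apply: has_integral_ge0; first exact: measurable_halfexp.
  by move=> x; rewrite /halfexp; case: ifP => // _; exact: expR_ge0.
have right : (\int[mu]_(x in `[(- a)%R, +oo[) (expR (- k * x))%:E
    = (expR (k * a) / k)%:E)%E.
  by rewrite integral_expR_right// mulrNN.
case: hs => ->.
- rewrite -right.
  (* For [s = 1] the reflection x -> -x leads to the right half line starting at [- a]; the endpoint
     is written [- - a] to fit that substitution. For [s = -1] the half line is already that one. *)
  transitivity (\int[mu]_(x in `]-oo, (- - a)%R]) (expR (k * x))%:E)%E.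
    rewrite [RHS]integral_mkcond; apply: eq_integral => x _.
    rewrite patchE /halfexp mul1r opprK.
    rewrite mem_setE in_itv /=.
    by case: ifP.
  rewrite ge0_integration_by_substitutionNy//.
  + by apply: eq_integral => x _ /=; rewrite mulrN mulNr.
  + exact/continuous_subspaceT/continuous_expRM.
- rewrite -right [RHS]integral_mkcond; apply: eq_integral => x _.
  rewrite patchE /halfexp mulN1r mem_setE in_itv /= andbT lerNl.
  by case: ifP => // _; rewrite mulrN mulNr.
Qed.

End has_integral.

(** * Exponential domination and the L^2 norm *)

Section L2.
Context {R : realType}.
Local Notation mu := (@lebesgue_measure R).
Implicit Types (f g : R -> R) (a b c k x : R).

(** Equality holds off the origin; both half lines contain 0, where the right-hand side is 2. *)
Lemma expRN_norm_le_halfexp k x : 0 < k ->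
  expR (- (k * `|x|)) <= halfexp 1 k 0 x + halfexp (-1) k 0 x.
Proof.
move=> k0; rewrite /halfexp mul1r mulN1r oppr_le0.
case: (ltgtP x 0) => [x0|x0|->].
- by rewrite ltr0_norm// mulrN opprK addr0.
- by rewrite gtr0_norm// mulrN add0r.
- by rewrite normr0 oppr0 mulr0 oppr0 lerDl expR_ge0.
Qed.

Lemma integrable_dominated k f C : 0 < k -> measurable_fun setT f ->
  (forall x, `|f x| <= C * expR (- (k * `|x|))) ->
  mu.-integrable setT (EFin \o f).
Proof.
move=> k0 mf fC.
have C0 : 0 <= C.
  by have := le_trans (normr_ge0 _) (fC 0); rewrite pmulr_lge0// expR_gt0.
have hl : (1 : R) = 1 \/ (1 : R) = -1 by left.
have hr : (-1 : R) = 1 \/ (-1 : R) = -1 by right.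
have [I _] := has_integralZ C
  (has_integralD (has_integral_halfexp 0 hl k0) (has_integral_halfexp 0 hr k0)).
apply: (le_integrable measurableT _ _ I); first exact/measurable_EFinP.
move=> x _ /=; rewrite lee_fin (le_trans (fC x))// (le_trans _ (ler_norm _))//.
by rewrite ler_wpM2l// expRN_norm_le_halfexp.
Qed.

Lemma L2_dominated f C : measurable_fun setT f ->
  (forall x, `|f x| <= C * phi x) -> L2 f.
Proof.
move=> mf fC.
have C0 : 0 <= C.
  by have := le_trans (normr_ge0 _) (fC 0); rewrite pmulr_lge0// expR_gt0.
(* Squaring the bound gives a multiple of exp(-2|x|), whence the decay rate 2. *)
have [] : mu.-integrable setT (EFin \o (fun x => f x ^+ 2)).
  apply: (@integrable_dominated 2 _ (C ^+ 2)) => //.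
    exact: measurable_funX.
  move=> x; rewrite normrX (_ : expR _ = phi x ^+ 2).
    by rewrite -exprMn lerXn2r ?nnegrE// mulr_ge0// expR_ge0.
  by rewrite /phi -expRM_natl mulrN.
move=> /integrableP[_ fi].
rewrite /L2 inE; apply/andP; split; first by rewrite inE.
rewrite inE /= /finite_norm unlock poweR_lty//.
apply: le_lt_trans fi; rewrite le_eqVlt; apply/orP; left; apply/eqP.
apply: eq_integral => x _ /=.
by rewrite normrX powR_mulrn.
Qed.

Lemma L2normZ f c : L2 f -> L2norm (fun x => c * f x) = (`|c|%:E * L2norm f)%E.
Proof.
move=> Lf.
have h : (1 <= 2%:E :> \bar R)%E by rewrite lee_fin ler1n.
exact: (LnormZ (Lfun_Sub h Lf) c).
Qed.

Lemma L2norm_fin f : L2 f -> L2norm f \is a fin_num.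
Proof.
rewrite /L2 inE => /andP[_]; rewrite inE /= /finite_norm => fi.
by rewrite ge0_fin_numE// Lnorm_ge0.
Qed.

(** The solution depends on time only through a scalar factor, so each limit in L^2 needed later
    reduces to a limit of real numbers. *)
Lemma L2norm_cvg0 f (T : Type) (F : set_system T) (FF : Filter F) (c : T -> R) :
  L2 f -> c h @[h --> F] --> (0 : R) ->
  L2norm (fun x => c h * f x) @[h --> F] --> 0%E.
Proof.
move=> Lf c0.
under eq_fun do rewrite L2normZ// -(fineK (L2norm_fin Lf)) -EFinM.
apply: (cvg_EFin (f := fun h => (`|c h| * fine (L2norm f))%:E)).
  exact: nearW.
have : `|c h| * fine (L2norm f) @[h --> F] --> `|0 : R| * fine (L2norm f).
  apply: cvgM; last exact: cvg_cst.
  exact: cvg_norm.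
by rewrite normr0 mul0r.
Qed.

(** Uniqueness of solutions gives equality almost everywhere only, and this makes it usable in the
    norm bound. *)
Lemma L2norm_ae f g : L2 f -> L2 g -> {ae mu, forall x, f x = g x} ->
  L2norm f = L2norm g.
Proof.
have mpow h : L2 h -> measurable_fun setT (fun x => `|(h x)%:E| `^ 2)%E.
  rewrite /L2 inE => /andP[]; rewrite inE /= => mh _.
  under eq_fun do rewrite /= powR_mulrn//.
  by apply/measurable_EFinP; apply: measurable_funX; exact: measurableT_comp.
move=> Lf Lg fg; rewrite /L2norm unlock; congr (_ `^ _)%E.
apply: ae_eq_integral => //; [exact: mpow|exact: mpow|].
by apply: filterS fg => x /= -> _.
Qed.

End L2.

(** * Test functions supported away from the origin *)

Section test_function.
Context {R : realType}.
Implicit Types x : R.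
Variable psi : R -> R.
Hypothesis psi_test : test_function psi.

Lemma test_function_derivable x : derivable psi x 1.
Proof. by have [h _ _] := psi_test; exact: (h 0%N). Qed.

Lemma test_function_derive1_derivable x : derivable (derive1 psi) x 1.
Proof. by have [h _ _] := psi_test; exact: (h 1%N). Qed.

Lemma test_function_continuous : continuous psi.
Proof.
move=> x; apply/differentiable_continuous/derivable1_diffP.
exact: test_function_derivable.
Qed.

Lemma test_function_derive1_continuous : continuous (derive1 psi).
Proof.
move=> x; apply/differentiable_continuous/derivable1_diffP.
exact: test_function_derive1_derivable.
Qed.

(** The complement of the closed support is open, so [psi] vanishes on a neighbourhood of [x] and
    its derivative vanishes with it. *)
Lemma test_function_notin_support x :
  ~ closure [set y | psi y != 0] x -> psi x = 0 /\ derive1 psi x = 0.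
Proof.
move=> nx.
have nz : \near x, psi x = 0.
  have : nbhs x (~` closure [set y | psi y != 0]).
    by apply: open_nbhs_nbhs; split => //; exact/closed_openC/closed_closure.
  apply: filterS => y ny; apply/eqP/negPn/negP => py.
  by apply: ny; exact: subset_closure.
split; first exact: nbhs_singleton nz.
have /near_eq_derive psi0 : \near x, psi x = cst 0 x by [].
by rewrite derive1E psi0 derive_cst.
Qed.

Lemma test_function_at0 : psi 0 = 0 /\ derive1 psi 0 = 0.
Proof.
by have [_ _ nz] := psi_test; apply: test_function_notin_support => /nz; exact.
Qed.

Lemma test_function_bounded_support :
  exists2 M, 0 < M & forall x, M <= `|x| -> psi x = 0 /\ derive1 psi x = 0.
Proof.
have [_ /compact_bounded[M [_ HM]] _] := psi_test.
(* Any number above [M] bounds the support; with [|M| + 1] as that bound, [|M| + 2] is positive and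
   lies strictly outside. *)
exists (`|M| + 2) => [|x Mx].
  by rewrite ltr_wpDl.
apply: test_function_notin_support => /(HM (`|M| + 1)) h.
have : `|x| <= `|M| + 1 by apply: h; rewrite (le_lt_trans (ler_norm M))// ltrDl.
by rewrite leNgt (lt_le_trans _ Mx)// ltrD2l ltr1n.
Qed.

End test_function.

(** * The mode phi + s phi' and its convolution integrals *)

Section mode.
Context {R : realType}.
Implicit Types (f g : R -> R) (a b c k x : R).

Lemma continuous_phi : continuous (@phi R).
Proof.
move=> x; apply: (continuous_comp (f := fun y : R => - `|y|) (g := expR)).
  apply: continuousN; exact: norm_continuous.
exact: continuous_expR.
Qed.

Lemma measurable_phi : measurable_fun setT (@phi R).
Proof. by apply: continuous_measurable_fun; exact: continuous_phi. Qed.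

Lemma dphiE x : dphi x = ((x < 0)%R%:R - (0 < x)%R%:R) * phi x.
Proof. by rewrite /dphi /phi; case: sgrP => _; rewrite /=; ring. Qed.

Lemma measurable_dphi : measurable_fun setT (@dphi R).
Proof.
rewrite (_ : dphi = fun x => ((x < 0)%R%:R - (0 < x)%R%:R) * phi x); last first.
  by apply/funext => x; exact: dphiE.
apply: measurable_funM; last exact: measurable_phi.
have mb (h : R -> bool) : measurable_fun setT h ->
    measurable_fun setT (fun x : R => (h x)%:R : R).
  move=> mh.
  rewrite (_ : (fun x => _) = (fun x => if h x then 1 else 0 : R)).
    exact: measurable_fun_ifT.
  by apply/funext => x; case: (h x).
by apply: measurable_funB; apply: mb; exact: measurable_fun_ltr.
Qed.

Variable s : R.
Hypothesis hs : s = 1 \/ s = -1.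

Definition mode (x : R) : R := phi x + s * dphi x.

(** Writing everything in terms of [s * x] lets a single case split on its sign cover both values of
    [s]. *)
Lemma phi_sign x : phi x = expR (- `|s * x|).
Proof. by rewrite /phi normrM; case: hs => ->; rewrite ?normrN normr1 mul1r. Qed.

Lemma dphi_sign x : dphi x = - s * Num.sg (s * x) * expR (- `|s * x|).
Proof.
by rewrite -phi_sign /dphi /phi sgrM; congr (_ * _); case: hs => ->;
  rewrite ?sgrN sgr1; ring.
Qed.

Lemma measurable_mode : measurable_fun setT mode.
Proof.
apply: measurable_funD; first exact: measurable_phi.
by apply: measurable_funM => //; exact: measurable_dphi.
Qed.

Lemma sqr_sign : s * s = 1. Proof. by case: hs => ->; rewrite ?mulrNN mulr1. Qed.

Lemma sign_mode x : s * mode x = dphi x + s * phi x.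
Proof. by rewrite /mode mulrDr mulrA sqr_sign mul1r addrC. Qed.

Lemma mode_neg x : s * x < 0 -> mode x = 2 * expR (s * x).
Proof.
move=> sx; rewrite /mode dphi_sign phi_sign ltr0_norm// ltr0_sg//.
by rewrite opprK mulrN1 opprK mulrA sqr_sign; ring.
Qed.

Lemma mode_pos x : 0 < s * x -> mode x = 0.
Proof.
move=> sx; rewrite /mode dphi_sign phi_sign gtr0_norm// gtr0_sg//.
by rewrite mulr1 mulrA mulrN sqr_sign; ring.
Qed.

Lemma normr_dphi_le x : `|dphi x| <= phi x.
Proof.
rewrite /dphi normrM -/(phi x) (ger0_norm (expR_ge0 _)).
by rewrite ler_piMl ?expR_ge0// normrN normr_sg; case: (x != 0).
Qed.

Lemma normr_mode_le x : `|mode x| <= 2 * phi x.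
Proof.
rewrite /mode (le_trans (ler_normD _ _))// mulr2n mulrDl mul1r lerD//.
  by rewrite ger0_norm// expR_ge0.
rewrite normrM (_ : `|s| = 1) ?mul1r ?normr_dphi_le//.
by case: hs => ->; rewrite ?normrN normr1.
Qed.

Lemma sign_neq0 x : x != 0 -> s * x != 0.
Proof. by move=> x0; case: hs => ->; rewrite ?mul1r ?mulN1r ?oppr_eq0. Qed.

(** The mode lives on s x < 0, where phi' = s phi. The origin is excluded: there [dphi] is 0 while
    [phi] and [mode] are 1. *)
Lemma dphi_mode x : x != 0 -> dphi x * mode x = s * (phi x * mode x).
Proof.
move/sign_neq0; case: ltgtP => // sx _; last by rewrite mode_pos ?mulr0.
by rewrite dphi_sign phi_sign ltr0_sg// mulrN1 opprK mulrA.
Qed.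

Lemma measurable_convolution_integrand f g x : measurable_fun setT f ->
  measurable_fun setT g -> measurable_fun setT (fun y : R => f (x - y) * g y).
Proof.
move=> mf mg; apply: measurable_funM => //.
by apply: (measurableT_comp mf); exact: measurable_funB.
Qed.

(* Both convolutions in Q (mode) are instances: since dphi mode = s phi mode off
   the origin, take al = 1, be = 0 for the kernel phi, and al = 0, be = - s for
   the kernel dphi. *)
Lemma has_integral_mode_kernel (al be : R) x :
  let X := s * x in let m := Num.min X 0 in
  has_integral
    (fun y => (al * phi (x - y) - be * s * dphi (x - y)) * (phi y * mode y))
    (2 * ((al + be) * (expR (- X) * (expR (3 * m) / 3)) +
          (al - be) * (expR X * (1 - expR m)))).
Proof.
move=> X m.
have I k a : 0 < k -> _ := has_integral_halfexp a hs.
have lt03 : 0 < 3 :> R by [].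
(* With Y = s y, the integrand is 2 (al + be) exp(-X) exp(3Y) for Y below [m], and 2 (al - be)
   exp(X) exp(Y) for Y between [m] and 0. The latter range is a difference of two half lines, empty
   when X >= 0. *)
have := has_integralZ 2 (has_integralD
  (has_integralZ ((al + be) * expR (- X)) (I _ m lt03))
  (has_integralZ ((al - be) * expR X)
    (has_integralD (I _ 0 ltr01) (has_integralZ (-1) (I _ m ltr01))))).
rewrite mulr0 expR0 !mul1r mulN1r !divr1 ?invr1 -!mulrA.
apply: has_integral_ae.
  apply: (measurable_convolution_integrand
    (f := fun z => al * phi z - be * s * dphi z) (g := phi \* mode)).
    by apply: measurable_funB; apply: measurable_funM => //;
      [exact: measurable_phi|exact: measurable_dphi].
  by apply: measurable_funM; [exact: measurable_phi|exact: measurable_mode].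
(* The points removed are the jump of the mode, y = 0, and the jump of the kernel [dphi (x - y)], y
   = x. *)
apply: filterS2 (ae_neq 0) (ae_neq x) => y /sign_neq0 y0 yx.
have : s * (x - y) != 0 by rewrite sign_neq0// subr_eq0 eq_sym.
rewrite !phi_sign dphi_sign mulrBr -/X /halfexp.
set Y := s * y in y0 *.
rewrite subr_eq0 => XY.
rewrite (_ : _ - _ =
  (al + be * Num.sg (X - Y)) * expR (- `|X - Y|)); last first.
  by rewrite !mulrA mulrN -(mulrA be) sqr_sign; ring.
case: (ltgtP Y 0) y0 => //= Y0 _; last first.
  have -> : Y <= m = false by rewrite le_min leNgt [Y <= 0]leNgt Y0 andbF.
  by rewrite mode_pos// -/Y; ring.
rewrite mode_neg// -/Y (ltr0_norm Y0) opprK mul1r.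
have -> : Y <= m = (Y < X).
  by rewrite le_min (ltW Y0) andbT le_eqVlt eq_sym (negPf XY).
have e3 : expR (3 * Y) = expR Y ^+ 3 by rewrite -expRM_natl.
case: (ltgtP Y X) XY => // XY _.
- rewrite gtr0_norm ?subr_gt0// gtr0_sg ?subr_gt0// opprB expRD e3.
  by ring.
- rewrite ltr0_norm ?subr_lt0// ltr0_sg ?subr_lt0// opprK expRD expRN.
  by field; rewrite gt_eqF ?expR_gt0.
Qed.

End mode.

(** * Action of the linearized operator on the mode *)

Section L_graph_mode.
Context {R : realType}.
Local Notation mu := (@lebesgue_measure R).
Implicit Types (f g : R -> R) (a b c k x : R).
Variable s : R.
Hypothesis hs : s = 1 \/ s = -1.
Local Notation mode := (mode s).

Lemma convolution_phi_mode c x :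
  let X := s * x in let m := Num.min X 0 in
  convolution phi (dphi \* (fun y => c * mode y)) x =
  2 * c * s * (expR (- X) * (expR (3 * m) / 3) + expR X * (1 - expR m)).
Proof.
move=> X m.
have := has_integralZ (c * s) (has_integral_mode_kernel hs 1 0 x).
rewrite !(addr0, subr0, mul1r) -/X -/m => I.
rewrite [RHS](_ : _ =
  c * s * (2 * (expR (- X) * (expR (3 * m) / 3) + expR X * (1 - expR m)))); last by ring.
apply: (has_integral_ae _ _ I).2.
  apply: measurable_convolution_integrand; first exact: measurable_phi.
  apply: measurable_funM; first exact: measurable_dphi.
  by apply: measurable_funM => //; exact: measurable_mode.
apply: filterS (ae_neq 0) => y y0 /=.
by rewrite mul0r !mul0r subr0 (mulrCA (dphi y)) dphi_mode//; ring.
Qed.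

Lemma convolution_dphi_mode c x :
  let X := s * x in let m := Num.min X 0 in
  convolution dphi (phi \* (fun y => c * mode y)) x =
  2 * c * s * (expR X * (1 - expR m) - expR (- X) * (expR (3 * m) / 3)).
Proof.
move=> X m.
have := has_integralZ c (has_integral_mode_kernel hs 0 (- s) x).
rewrite !(add0r, sub0r) opprK -/X -/m => I.
rewrite [RHS](_ : _ = c * (2 * (- s * (expR (- X) * (expR (3 * m) / 3)) +
  s * (expR X * (1 - expR m))))); last by ring.
apply: (has_integral_ae _ _ I).2.
  apply: measurable_convolution_integrand; first exact: measurable_dphi.
  apply: measurable_funM; first exact: measurable_phi.
  by apply: measurable_funM => //; exact: measurable_mode.
apply: nearW => y /=.
by rewrite mul0r mulNr sqr_sign//; ring.
Qed.

(** On s x < 0, [Q] contributes c s (-b exp(sx) + (2b - 2) exp(2sx)); the exp(2sx) terms cancel,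
    since -2 + (4 - 2b) + (2b - 2) = 0. On s x > 0 the local terms vanish and [Q] alone gives the
    result. *)
Lemma L_mode b c x : x != 0 ->
  (1 - phi x) * (c * s * mode x) + (2 - b) * dphi x * (c * mode x) +
  Q b (fun y => c * mode y) x = c * (2 - b) * dphi x.
Proof.
move=> /(sign_neq0 hs) sx0.
rewrite /Q convolution_phi_mode convolution_dphi_mode.
rewrite (phi_sign hs) (dphi_sign hs).
case: ltgtP sx0 => // sx _.
- rewrite mode_neg// ltr0_norm// ltr0_sg// opprK.
  rewrite expRM_natl expRN.
  by field; rewrite gt_eqF ?expR_gt0.
- rewrite mode_pos// gtr0_norm// gtr0_sg// !mulr0 expR0 expRN.
  by field; rewrite gt_eqF ?expR_gt0.
Qed.

Lemma inner_mode c :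
  inner (phi \* dphi) (fun x => c * mode x) = c * s * (2 / 3).
Proof.
have lt03 : 0 < 3 :> R by [].
(* On s x < 0 the product phi phi' mode equals 2 s exp(3 s x). *)
have := has_integralZ (2 * c * s) (has_integral_halfexp 0 hs lt03).
rewrite mulr0 expR0 => I.
have -> : c * s * (2 / 3) = 2 * c * s * (1 / 3) by ring.
apply: (has_integral_ae _ _ I).2.
  apply: measurable_funM.
    by apply: measurable_funM; [exact: measurable_phi|exact: measurable_dphi].
  by apply: measurable_funM => //; exact: measurable_mode.
apply: filterS (ae_neq 0) => x /(sign_neq0 hs) x0.
rewrite /halfexp /= (phi_sign hs) (dphi_sign hs).
case: ltgtP x0 => // sx _; last by rewrite mode_pos// !mulr0.
rewrite mode_neg// ltr0_norm// ltr0_sg// opprK expRM_natl.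
by ring.
Qed.

(** The factors 3/2 and 2/3 cancel, leaving c (2 - b) (phi' + s phi), and s^2 = 1 identifies the
    bracket with s times the mode. *)
Lemma linearized_rhs_mode b c x :
  c * (2 - b) * dphi x - 3 / 2 * (b - 2) * (c * s * (2 / 3)) * phi x =
  s * (2 - b) * (c * mode x).
Proof.
have -> : s * (2 - b) * (c * mode x) = c * (2 - b) * (s * mode x) by ring.
by rewrite sign_mode//; field.
Qed.

Lemma L2_mode c : L2 (fun x => c * mode x).
Proof.
apply: (@L2_dominated _ _ (`|c| * 2)).
  by apply: measurable_funM => //; exact: measurable_mode.
by move=> x; rewrite normrM -mulrA ler_wpM2l// normr_mode_le.
Qed.

Lemma L2_dphi c : L2 (fun x => c * dphi x).
Proof.
apply: (@L2_dominated _ _ `|c|).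
  by apply: measurable_funM => //; exact: measurable_dphi.
by move=> x; rewrite normrM ler_wpM2l// normr_dphi_le.
Qed.

Lemma integrable_mode c : mu.-integrable setT (EFin \o (fun x => c * mode x)).
Proof.
apply: (@integrable_dominated _ 1 _ (`|c| * 2)) => //.
  by apply: measurable_funM => //; exact: measurable_mode.
by move=> x; rewrite normrM -mulrA ler_wpM2l// mul1r normr_mode_le.
Qed.

Lemma L2_weighted_mode c : L2 (fun x => (1 - phi x) * (c * mode x)).
Proof.
apply: (@L2_dominated _ _ (`|c| * 2)).
  apply: measurable_funM.
    by apply: measurable_funB => //; exact: measurable_phi.
  by apply: measurable_funM => //; exact: measurable_mode.
move=> x; rewrite !normrM (le_trans (ler_piMl _ _))//.
  have p0 : 0 <= phi x := expR_ge0 _.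
  have p1 : phi x <= 1 by rewrite /phi -[leRHS]expR0 ler_expR oppr_le0.
  by rewrite ger0_norm ?subr_ge0// gerBl.
by rewrite -mulrA ler_wpM2l// normr_mode_le.
Qed.

End L_graph_mode.

(** * Weak derivative, domain membership and nonzero norm of the mode *)

Section weak_derivative_mode.
Context {R : realType}.
Local Notation mu := (@lebesgue_measure R).
Implicit Types (f g : R -> R) (a b c k x : R).

Variable s : R.
Hypothesis hs : s = 1 \/ s = -1.
Local Notation mode := (mode s).

(** Reduces to a compact interval on which the mode is replaced by a smooth exponential, ready for
    integration by parts. [Num.min] and [Num.max] order the endpoints 0 and -s M for either sign;
    [h 0 = 0] absorbs the mismatch at 0, where the mode is 1 and not 2. *)
Lemma Rintegral_mode_mul c (M : R) h : 0 < M -> h 0 = 0 ->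
  (forall x, M <= `|x| -> h x = 0) ->
  \int[mu]_x (c * mode x * h x) =
  \int[mu]_(x in `[Num.min (- (s * M)) 0, Num.max (- (s * M)) 0])
    (2 * c * expR (s * x) * h x).
Proof.
move=> M0 h0 hM; rewrite [RHS]Rintegral_mkcond.
apply: eq_Rintegral => x _; rewrite patchE mem_setE in_itv /=.
have -> : (Num.min (- (s * M)) 0 <= x <= Num.max (- (s * M)) 0) =
    (- M <= s * x <= 0).
  case: hs => ->.
    by rewrite !mul1r min_l ?max_r// oppr_le0 ltW.
  rewrite !mulN1r opprK (min_r (ltW M0)) (max_l (ltW M0)).
  by rewrite lerN2 oppr_le0 andbC.
have [sx|sx|sx] := ltgtP (s * x) 0.
- rewrite mode_neg//; case: leP => sM; first by ring.
  rewrite hM ?mulr0// (_ : `|x| = `|s * x|).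
    by rewrite ltr0_norm// lerNr ltW.
  by rewrite normrM; case: hs => ->; rewrite ?normrN normr1 mul1r.
- by rewrite mode_pos// andbF mulr0 mul0r.
- suff -> : x = 0 by rewrite h0 !mulr0; case: ifP.
  by apply/eqP; apply: contraTT isT => /(sign_neq0 hs); rewrite sx eqxx.
Qed.

Lemma weak_derivative_mode c :
  weak_derivative (fun x => c * mode x) (fun x => c * s * mode x).
Proof.
split.
  apply: open_integrable_locally.
    exact/closed_openC/accessible_closed_set1/hausdorff_accessible/Rhausdorff.
  apply: (integrableS measurableT) => //; last exact: integrable_mode.
  exact: measurableC.
move=> psi tpsi.
have [M M0 HM] := test_function_bounded_support tpsi.
have [p0 dp0] := test_function_at0 tpsi.
rewrite (@Rintegral_mode_mul c M)//; last by move=> x /HM[].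
rewrite (@Rintegral_mode_mul (c * s) M)//; last by move=> x /HM[].
set l := Num.min _ _; set r := Num.max _ _.
have lr : l < r.
  rewrite /l /r; case: hs => ->.
    by rewrite mul1r min_l ?max_r ?oppr_lt0// oppr_le0 ltW.
  by rewrite mulN1r opprK min_r ?max_l// ltW.
(* Both boundary terms vanish: one endpoint is the origin, so the jump of the mode is not seen, and
   the other has absolute value [M]. *)
have [pl pr] : psi l = 0 /\ psi r = 0.
  rewrite /l /r; case: hs => ->.
    rewrite mul1r min_l ?max_r ?oppr_lt0//; try by rewrite oppr_le0 ltW.
    by split=> //; apply: (HM _ _).1; rewrite normrN ler_norm.
  rewrite mulN1r opprK min_r ?max_l//; try by rewrite ltW.
  by split=> //; apply: (HM _ _).1; rewrite ler_norm.
have cE k : continuous (fun x => k * expR (s * x)).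
  by move=> x; apply: cvgM; [exact: cvg_cst|exact: continuous_expRM].
rewrite (@Rintegration_by_parts _ (fun x => 2 * c * expR (s * x)) psi
  (fun x => 2 * (c * s) * expR (s * x)) (derive1 psi))//.
- by rewrite pl pr !mulr0 subrr sub0r.
- exact: continuous_subspaceT.
- split.
  + by move=> x _; exact: ex_derive.
  + by apply: cvg_at_right_filter; exact: cE.
  + by apply: cvg_at_left_filter; exact: cE.
- move=> x _; rewrite derive1E derive_val /GRing.scale /=; ring.
- by apply: continuous_subspaceT; exact: test_function_derive1_continuous.
- split.
  + by move=> x _; exact: test_function_derivable.
  + by apply: cvg_at_right_filter; exact: test_function_continuous.
  + by apply: cvg_at_left_filter; exact: test_function_continuous.
Qed.

Lemma L_graph_mode b c :
  L_graph b (fun x => c * mode x) (fun x => c * (2 - b) * dphi x).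
Proof.
split; first exact: L2_mode.
exists (fun x => c * s * mode x); split.
- exact: weak_derivative_mode.
- exact: L2_weighted_mode.
- by apply: filterS (ae_neq 0) => x x0; rewrite L_mode.
Qed.

Lemma DomL_mode c : DomL (fun x => c * mode x).
Proof.
split; first exact: L2_mode.
exists (fun x => c * s * mode x); first exact: weak_derivative_mode.
exact: L2_weighted_mode.
Qed.

(** A zero norm would make the mode vanish almost everywhere and have integral 0, whereas its
    integral is 2. *)
Lemma L2norm_mode_gt0 : (0 < L2norm mode)%E.
Proof.
rewrite lt0e Lnorm_ge0 andbT; apply/eqP => m0.
have mm := measurable_mode s.
have /measurable_EFinP mE := mm.
have lt02 : (0 < 2%:E :> \bar R)%E by rewrite lte_fin.
have I := has_integral_halfexp 0 hs (@ltr01 R).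
have [_ i0] : has_integral mode (0 * (expR (1 * 0) / 1)).
  apply: has_integral_ae (has_integralZ 0 I) => //.
  apply: filterS (@Lnorm_eq0_eq0 _ _ _ mu _ _ mE lt02 m0) => x /(_ Logic.I) /= [->].
  by rewrite mul0r.
have [_ i2] : has_integral mode (2 * (expR (1 * 0) / 1)).
  apply: has_integral_ae (has_integralZ 2 I) => //.
  apply: filterS (ae_neq 0) => x /(sign_neq0 hs).
  rewrite /halfexp mul1r; case: ltgtP => // sx _; first by rewrite mode_neg.
  by rewrite mode_pos// mulr0.
by move: i2; rewrite i0 mulr0 expR0 mul0r; lra.
Qed.

End weak_derivative_mode.

(** * Regularity in time of the growing mode *)

Section growing_mode.
Context {R : realType}.
Implicit Types (f g : R -> R) (a c k x : R).

Variable s : R.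
Hypothesis hs : s = 1 \/ s = -1.
Local Notation mode := (mode s).

Lemma L2_mode1 : L2 mode.
Proof. by have := L2_mode hs 1; under eq_fun do rewrite mul1r. Qed.

Lemma L2_dphi1 : L2 (@dphi R).
Proof. by have := L2_dphi (1 : R); under eq_fun do rewrite mul1r. Qed.

Lemma graph_norm_mode_cvg0 b (T : Type) (F : set_system T) (FF : Filter F)
    (c : T -> R) : c h @[h --> F] --> (0 : R) ->
  graph_norm b (fun x => c h * mode x) @[h --> F] --> 0%E.
Proof.
move=> c0.
have c20 : c h * (2 - b) @[h --> F] --> (0 : R).
  by rewrite -[X in _ --> X](mul0r (2 - b)); apply: cvgM => //; exact: cvg_cst.
(* The graph norm is an infimum, so the explicit representative of L applied to the mode bounds it
   from above. *)
apply: (squeeze_cvge (f := cst 0%E) (h := fun h =>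
  (L2norm (fun x => c h * mode x)%R +
   L2norm (fun x => c h * (2 - b) * dphi x)%R)%E)).
- apply: nearW => h; apply/andP; split.
    apply: le_ereal_inf_tmp => _ [f _ <-].
    by rewrite adde_ge0// Lnorm_ge0.
  by apply: ereal_inf_lbound; exists (fun x => c h * (2 - b) * dphi x) => //;
    exact: L_graph_mode.
- exact: cvg_cst.
- rewrite -[X in _ --> X]adde0; apply: cvgeD => //.
    by apply: L2norm_cvg0 => //; exact: L2_mode1.
  by apply: L2norm_cvg0 => //; exact: L2_dphi1.
Qed.

Variable lam : R.

Definition growing_mode t x := expR (lam * t) * mode x.

Lemma growing_modeB t u :
  growing_mode u \- growing_mode t =
  (fun x => (expR (lam * u) - expR (lam * t)) * mode x).
Proof. by apply/funext => x; rewrite /growing_mode /= mulrBl. Qed.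

Lemma cvg_expRMB t : expR (lam * u) - expR (lam * t) @[u --> t] --> (0 : R).
Proof.
rewrite -[X in _ --> X](subrr (expR (lam * t))).
by apply: cvgB; [exact: continuous_expRM|exact: cvg_cst].
Qed.

Lemma C_DomL_growing_mode b : C_DomL b growing_mode.
Proof.
split=> t; first exact: DomL_mode.
under eq_fun do rewrite growing_modeB.
by apply: graph_norm_mode_cvg0; exact: cvg_expRMB.
Qed.

Lemma C_L2_growing_mode k : C_L2 (fun t x => k * growing_mode t x).
Proof.
split=> t.
  by under eq_fun do rewrite /growing_mode mulrA; exact: L2_mode.
have -> : (fun u => L2norm
    ((fun x => k * growing_mode u x) \- (fun x => k * growing_mode t x)))
  = (fun u => L2norm (fun x => k * (expR (lam * u) - expR (lam * t)) * mode x)).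
  apply/funext => u; congr L2norm; apply/funext => x.
  by rewrite /growing_mode /=; ring.
apply: L2norm_cvg0; first exact: L2_mode1.
rewrite -[X in _ --> X](mulr0 k).
by apply: cvgM; [exact: cvg_cst|exact: cvg_expRMB].
Qed.

Lemma L2_derivative_growing_mode t :
  L2_derivative growing_mode t (fun x => lam * growing_mode t x).
Proof.
split; first by under eq_fun do rewrite /growing_mode mulrA; exact: L2_mode.
have -> : (fun h => L2norm (fun x =>
      h^-1 * (growing_mode (t + h) x - growing_mode t x)
      - lam * growing_mode t x)) =
  (fun h => L2norm (fun x => (h^-1 * (expR (lam * (t + h)) - expR (lam * t))
      - lam * expR (lam * t)) * mode x)).
  apply/funext => u; congr L2norm; apply/funext => x.
  by rewrite /growing_mode /=; ring.
apply: L2norm_cvg0; first exact: L2_mode1.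
have d : is_derive t 1 (fun u => expR (lam * u)) (lam * expR (lam * t)).
  apply: is_derive_eq; rewrite /GRing.scale /=; ring.
rewrite -[X in _ --> X](subrr (lam * expR (lam * t))).
apply: cvgB; last exact: cvg_cst.
have [dd <-] := d.
have -> : (fun h : R => h^-1 * (expR (lam * (t + h)) - expR (lam * t))) =
    (fun h : R => h^-1 *: (expR (lam * (h *: 1 + t)) - expR (lam * t))).
  by apply/funext => h; rewrite /GRing.scale /= mulr1 (addrC t).
exact: dd.
Qed.

End growing_mode.

(** * The exponential solution and the contradiction with stability *)

Lemma solution_growing_mode (R : realType) (b s : R) (hs : s = 1 \/ s = -1) :
  solution_in b (class_Y b) (mode s) (growing_mode s (s * (2 - b))).
Proof.
split; first split.
- exact: C_DomL_growing_mode.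
- split.
    have := C_L2_growing_mode hs (s * (2 - b)) 1.
    by under [X in C_L2 X -> _]eq_fun do under eq_fun do rewrite mul1r.
  exists (fun t x => s * (2 - b) * growing_mode s (s * (2 - b)) t x).
    by move=> t; exact: L2_derivative_growing_mode.
  exact: C_L2_growing_mode.
- move=> t; exists (fun x => expR (s * (2 - b) * t) * (2 - b) * dphi x).
    exact: L_graph_mode.
  have := L2_derivative_growing_mode hs (s * (2 - b)) t.
  congr (L2_derivative _ _ _); apply/funext => x.
  rewrite (inner_mode hs).
  by rewrite linearized_rhs_mode.
- by apply: nearW => x; rewrite /growing_mode mulr0 expR0 mul1r.
Qed.

Theorem corollary2p6 (R : realType) (b : R) (hb : b != 2) :
  peakon_linearly_unstable b (class_Y b).
Proof.
have [s hs lam0] : exists2 s : R, s = 1 \/ s = -1 & 0 < s * (2 - b).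
  have [b2|b2|b2] := ltgtP b 2.
  - by exists 1; [left|rewrite mul1r subr_gt0].
  - by exists (-1); [right|rewrite mulN1r opprB subr_gt0].
  - by rewrite b2 eqxx in hb.
move=> stable.
have /stable[C [C0 [v [hv uniq bound]]]] : DomL (mode s).
  have := DomL_mode hs 1.
  by under [X in DomL X -> _]eq_fun do rewrite mul1r.
(* At this time the growth factor is exp(C) >= 1 + C > C, which contradicts the stability bound. *)
have tC : 0 < C / (s * (2 - b)) by exact: divr_gt0.
have := bound _ tC.
(* Uniqueness identifies the solution supplied by stability with the growing mode. *)
have -> : L2norm (v (C / (s * (2 - b)))) =
    L2norm (growing_mode s (s * (2 - b)) (C / (s * (2 - b)))).
  apply: L2norm_ae; last first.
  - apply: filterS (uniq _ (solution_growing_mode b hs) (C / (s * (2 - b)))).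
    by move=> x ->.
  - exact: L2_mode.
  - by have [[[dom _] _] _ _] := hv; have [] := dom (C / (s * (2 - b))).
have n0 := L2norm_mode_gt0 hs.
rewrite L2normZ; last exact: L2_mode1.
rewrite -(fineK (L2norm_fin (L2_mode1 hs))) -!EFinM lee_fin.
rewrite ger0_norm ?expR_ge0// mulrCA divff ?mulr1 ?gt_eqF//.
rewrite ler_pM2r; last first.
  rewrite -lte_fin fineK ?n0//; exact/L2norm_fin/L2_mode1.
have := expR_ge1Dx C.
lra.
Qed.
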